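(* Let $n$ be a positive integer and let \[ W = (n\mathbb{N} + A) \cup F \cup G, \] where $A$ is a nonempty finite set of integers, $F$ is a finite set of integers with $(F \bmod n) \subseteq (A \bmod n)$, and $G$ is a (possibly infinite) set of integers with $(G \bmod n) \cap (A \bmod n) = \emptyset$ such that all elements of $G$ lie in a single residue class modulo $n$. Write $W \bmod n$, $A \bmod n$, etc. for the sets of residues in $\mathbb{Z}/n\mathbb{Z}$ of the elements of these sets. Suppose there exists $S \subseteq \mathbb{Z}/n\mathbb{Z}$ such that (i) $S + (W \bmod n) = \mathbb{Z}/n\mathbb{Z}$, and (ii) for every $s \in S$ there exists $g \in G$ such that $s + (g \bmod n) \notin (S \setminus \{s\}) + (W \bmod n)$. If $G$ has a minimal additive complement, then $W$ has a minimal additive complement.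
   Context: $\mathbb{N}$ denotes the set of nonnegative integers, and $n\mathbb{N} + A = \{nk + a : k \in \mathbb{N}, a \in A\}$. For $X, Y \subseteq \mathbb{Z}$, $X + Y = \{x + y : x \in X, y \in Y\}$. A set $C \subseteq \mathbb{Z}$ is an additive complement to $W \subseteq \mathbb{Z}$ if $C + W = \mathbb{Z}$; it is a minimal additive complement to $W$ if moreover no proper subset of $C$ is an additive complement to $W$. *)

(* Defs.v *)
From Stdlib Require Import ZArith List.
Open Scope Z_scope.

Definition additive_complement (C W : Z -> Prop) : Prop :=
  forall z : Z, exists c w, C c /\ W w /\ z = c + w.

Definition minimal_additive_complement (C W : Z -> Prop) : Prop :=
  additive_complement C W /\
  forall C' : Z -> Prop, (forall x, C' x -> C x) -> additive_complement C' W ->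
    forall x, C x -> C' x.

Definition has_minimal_complement (W : Z -> Prop) : Prop :=
  exists C, minimal_additive_complement C W.

Definition finite_set (A : Z -> Prop) : Prop :=
  exists l : list Z, forall x, A x <-> In x l.

Definition dil_plus (n : Z) (A : Z -> Prop) : Z -> Prop :=
  fun x => exists k a, 0 <= k /\ A a /\ x = n * k + a.

Definition union3 (X Y Z' : Z -> Prop) : Z -> Prop :=
  fun x => X x \/ Y x \/ Z' x.

(* Residues modulo n are represented by their canonical representatives in
   [0, n); "X mod n" is the set of residues of elements of X. *)
Definition mod_set (n : Z) (X : Z -> Prop) : Z -> Prop :=
  fun r => exists x, X x /\ r = x mod n.

(* Main.v *)
(** If [G] is bounded below, let [D] be a minimal complement of [G].  As [G]
    lies in one class [gamma] mod [n], for every residue [s] the part of [D]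
    congruent to [s] is a minimal complement of [G] relative to the class
    [s + gamma], and it is unbounded below.  The elements of [D] with residue
    in [S] then form a minimal complement of [W]: unboundedness below makes
    [n N + A] cover whole classes, and (ii) says that the class [s + gamma]
    is reached only through [G].

    If [G] is unbounded below, [W] is unbounded in both directions and has a
    minimal complement by a theorem of Chen and Yang.  Either some finite
    interval is a complement of [W], or [W] has arbitrarily long gaps; in the
    latter case each [z] is covered as [c + w] with [w] next to a long gap, so
    that [c + W] misses all other integers of absolute value at most [|z|].
    Both cases yield a complement representing each integer finitely often,
    and removing superfluous elements one at a time preserves coverage in the
    limit. *)

Require Import Defs.
From Stdlib Require Import ZArith List Lia Classical ClassicalEpsilon Cantor.
Open Scope Z_scope.

Lemma mod_eq_iff (n x y : Z) :
  0 < n -> (x mod n = y mod n <-> exists k, x = y + n * k).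
Proof.
  intros Hn; split.
  - intros H; exists (x / n - y / n).
    pose proof (Z.div_mod x n); pose proof (Z.div_mod y n); lia.
  - intros [k ->]. rewrite (Z.mul_comm n k). apply Z.mod_add; lia.
Qed.

(** * Pruning a complement along an enumeration of the integers *)

Definition int_enum (k : nat) : Z :=
  Z.of_nat (fst (Cantor.of_nat k)) - Z.of_nat (snd (Cantor.of_nat k)).

Lemma int_enum_surj (z : Z) : exists k, int_enum k = z.
Proof.
  exists (Cantor.to_nat (Z.to_nat z, Z.to_nat (- z))).
  unfold int_enum. rewrite Cantor.cancel_of_to. cbn [fst snd]. lia.
Qed.

Lemma int_enum_bound (l : list Z) :
  exists K, forall c, In c l -> exists k, (k < K)%nat /\ int_enum k = c.
Proof.
  induction l as [|a l [K IH]].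
  - exists 0%nat. intros c [].
  - destruct (int_enum_surj a) as [k0 Hk0].
    exists (S (max k0 K)). intros c [<-|Hc].
    + exists k0. split; [lia|assumption].
    + destruct (IH c Hc) as (k & Hk & E). exists k. split; [lia|assumption].
Qed.

Definition remove_point (C : Z -> Prop) (a : Z) : Z -> Prop :=
  fun x => C x /\ x <> a.

Lemma additive_complement_mono (C C' W : Z -> Prop) :
  (forall x, C x -> C' x) -> additive_complement C W -> additive_complement C' W.
Proof.
  intros Hsub H z. destruct (H z) as (c & w & Hc & Hw & E).
  exists c, w; auto.
Qed.

Fixpoint prune (C W : Z -> Prop) (k : nat) : Z -> Prop :=
  match k with
  | O => C
  | S k => fun x =>
      prune C W k x /\
      ~ (x = int_enum k /\
         additive_complement (remove_point (prune C W k) (int_enum k)) W)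
  end.

Lemma prune_antitone (C W : Z -> Prop) (j k : nat) :
  (j <= k)%nat -> forall x, prune C W k x -> prune C W j x.
Proof.
  induction 1 as [|k _ IH]; intros x Hx; [assumption|].
  destruct Hx as [Hx _]. auto.
Qed.

Lemma prune_complement (C W : Z -> Prop) (k : nat) :
  additive_complement C W -> additive_complement (prune C W k) W.
Proof.
  intros HC. induction k as [|k IH]; [assumption|].
  destruct (classic (additive_complement
    (remove_point (prune C W k) (int_enum k)) W)) as [H|H].
  - revert H. apply additive_complement_mono.
    intros x [Hx Hne]. split; [assumption|]. intros [E _]. contradiction.
  - revert IH. apply additive_complement_mono.
    intros x Hx. split; [assumption|]. intros [_ H']. contradiction.
Qed.

Lemma prune_needed (C W : Z -> Prop) (k : nat) :
  prune C W (S k) (int_enum k) ->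
  ~ additive_complement (remove_point (prune C W k) (int_enum k)) W.
Proof. intros [_ H] H'. apply H. split; [reflexivity|assumption]. Qed.

(** [int_enum] repeats values, so a kept point may be examined again. The later set is smaller, so a
    deletion possible there would have been possible at stage [k]. *)
Lemma prune_stable (C W : Z -> Prop) (k m : nat) :
  prune C W (S k) (int_enum k) -> prune C W m (int_enum k).
Proof.
  intros Hk. destruct (Nat.le_gt_cases m (S k)) as [Hm|Hm].
  - exact (prune_antitone C W m (S k) Hm _ Hk).
  - induction m as [|m IH]; [lia|].
    assert (Hx : prune C W m (int_enum k)).
    { destruct (Nat.eq_dec m (S k)) as [->|]; [assumption|]. apply IH; lia. }
    split; [assumption|]. intros [E H].
    apply (prune_needed C W k Hk). rewrite E. revert H.
    apply additive_complement_mono. intros x [Hxm Hne].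
    split; [|assumption]. revert Hxm. apply prune_antitone. lia.
Qed.

(** Only finitely many [c] can represent [z]. Once all have been examined, one that still represents
    [z] survives forever, so the limit of the pruning covers [z]. *)
Lemma locally_finite_complement_minimal (C W : Z -> Prop) :
  additive_complement C W ->
  (forall z, exists l : list Z, forall c, C c -> W (z - c) -> In c l) ->
  has_minimal_complement W.
Proof.
  intros HC Hfin. exists (fun x => forall k, prune C W k x). split.
  - intros z. destruct (Hfin z) as [l Hl].
    destruct (int_enum_bound l) as [K HK].
    destruct (prune_complement C W K HC z) as (c & w & Hc & Hw & E).
    exists c, w. split; [|auto]. intros m.
    assert (Hcl : In c l).
    { apply Hl.
      - exact (prune_antitone C W 0 K (Nat.le_0_l K) c Hc).
      - replace (z - c) with w by lia. assumption. }
    destruct (HK c Hcl) as (k & Hk & <-). apply prune_stable.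
    revert Hc. apply prune_antitone. lia.
  - intros C' Hsub HC' x Hx. apply NNPP. intros Hn.
    destruct (int_enum_surj x) as [k <-].
    apply (prune_needed C W k (Hx (S k))). revert HC'.
    apply additive_complement_mono. intros y Hy. split.
    + exact (Hsub y Hy k).
    + intros ->. contradiction.
Qed.

(** * Elements next to long gaps *)

Lemma least_above (W : Z -> Prop) (x w : Z) :
  W w -> x <= w ->
  exists v, W v /\ x <= v /\ forall y, x <= y < v -> ~ W y.
Proof.
  intros Hw Hx. revert Hx Hw.
  induction w as [w IH] using (well_founded_induction (Z.lt_wf x)).
  intros Hx Hw.
  destruct (classic (exists y, x <= y < w /\ W y)) as [(y & Hy & HWy)|H].
  - apply (IH y); [lia|lia|assumption].
  - exists w. repeat split; [assumption|assumption|].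
    intros y Hy HWy. apply H. exists y. auto.
Qed.

Lemma element_after_gap (W : Z -> Prop) :
  (forall x, exists w, W w /\ x <= w) ->
  (forall L, exists x, forall i, 0 <= i <= L -> ~ W (x + i)) ->
  forall L, exists w, W w /\ forall i, 0 < i <= L -> ~ W (w - i).
Proof.
  intros Hup Hgap L. destruct (Hgap L) as [x Hx].
  destruct (Hup x) as (w & Hw & Hxw).
  destruct (least_above W x w Hw Hxw) as (v & Hv & Hxv & Hleast).
  exists v. split; [assumption|]. intros i Hi.
  destruct (Z_le_gt_dec x (v - i)).
  - apply Hleast. lia.
  - intros _. apply (Hx (v - x)); [lia|].
    replace (x + (v - x)) with v by lia. assumption.
Qed.

Lemma element_before_gap (W : Z -> Prop) :
  (forall x, exists w, W w /\ w <= x) ->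
  (forall L, exists x, forall i, 0 <= i <= L -> ~ W (x + i)) ->
  forall L, exists w, W w /\ forall i, 0 < i <= L -> ~ W (w + i).
Proof.
  intros Hdown Hgap L.
  (* Reflection in 0 exchanges the two ends of a gap. *)
  destruct (element_after_gap (fun x => W (- x))) with (L := L)
    as (w & Hw & H).
  - intros x. destruct (Hdown (- x)) as (w & Hw & Hle).
    exists (- w). rewrite Z.opp_involutive. split; [assumption|lia].
  - intros M. destruct (Hgap M) as [x Hx]. exists (- x - M). intros i Hi.
    replace (- (- x - M + i)) with (x + (M - i)) by lia. apply Hx. lia.
  - exists (- w). split; [assumption|]. intros i Hi.
    replace (- w + i) with (- (w - i)) by lia. auto.
Qed.

(** * Sets unbounded in both directions *)

Lemma bounded_finite (f : Z -> Z) (b : nat) :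
  exists l, forall z, Z.abs z <= Z.of_nat b -> In (f z) l.
Proof.
  induction b as [|b [l IH]].
  - exists (f 0 :: nil). intros z Hz. left. f_equal. lia.
  - exists (f (Z.of_nat (S b)) :: f (- Z.of_nat (S b)) :: l). intros z Hz.
    destruct (Z_le_gt_dec (Z.abs z) (Z.of_nat b)) as [H|H].
    + right. right. auto.
    + destruct (Z_le_gt_dec 0 z); [left|right; left]; f_equal; lia.
Qed.

Theorem unbounded_has_minimal_complement (W : Z -> Prop) :
  (forall x, exists w, W w /\ x <= w) ->
  (forall x, exists w, W w /\ w <= x) ->
  has_minimal_complement W.
Proof.
  intros Hup Hdown.
  destruct (classic (exists L, additive_complement (fun c => - L <= c <= 0) W))
    as [[L HL]|Hno].
  - apply (locally_finite_complement_minimal _ W HL). intros z.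
    destruct (bounded_finite (fun x => x) (Z.to_nat L)) as [l Hl].
    exists l. intros c Hc _. apply Hl. lia.
  - assert (Hgap : forall L, exists x, forall i, 0 <= i <= L -> ~ W (x + i)).
    { intros L. apply NNPP. intros Hn. apply Hno. exists L. intros z.
      apply NNPP. intros Hz. apply Hn. exists z. intros i Hi Hw.
      apply Hz. exists (- i), (z + i). repeat split; [lia|lia|assumption|lia]. }
    assert (Hf : forall z, exists c, W (z - c) /\
              forall y, Z.abs y <= Z.abs z -> y <> z -> ~ W (y - c)).
    (* All other [y] with [|y| <= |z|] lie on one side of [z], at distance at most [2|z|]; a gap of
       that length on that side suffices. *)
    { intros z. destruct (Z_le_gt_dec 0 z) as [Hz|Hz].
      - destruct (element_after_gap W Hup Hgap (2 * z)) as (w & Hw & H).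
        exists (z - w). split.
        + replace (z - (z - w)) with w by lia. assumption.
        + intros y Hy Hne. replace (y - (z - w)) with (w - (z - y)) by lia.
          apply H. lia.
      - destruct (element_before_gap W Hdown Hgap (- 2 * z)) as (w & Hw & H).
        exists (z - w). split.
        + replace (z - (z - w)) with w by lia. assumption.
        + intros y Hy Hne. replace (y - (z - w)) with (w + (y - z)) by lia.
          apply H. lia. }
    set (f := fun z => proj1_sig (constructive_indefinite_description _ (Hf z))).
    assert (HfW : forall z, W (z - f z) /\
              forall y, Z.abs y <= Z.abs z -> y <> z -> ~ W (y - f z)).
    { intros z. exact (proj2_sig (constructive_indefinite_description _ (Hf z))). }
    apply (locally_finite_complement_minimal (fun c => exists z, c = f z)).
    + intros z. exists (f z), (z - f z).
      split; [exists z; reflexivity|]. split; [apply HfW|lia].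
    + intros y. destruct (bounded_finite f (Z.to_nat (Z.abs y))) as [l Hl].
      exists l. intros c [z ->] HW. apply Hl.
      destruct (Z_le_gt_dec (Z.abs z) (Z.abs y)) as [H|H]; [lia|].
      exfalso. apply (proj2 (HfW z) y); [lia|lia|assumption].
Qed.

(** * Complements of [W] from complements of [G] *)

Theorem theorem6 (n : Z) (A F G : Z -> Prop) :
  0 < n ->
  finite_set A -> (exists a, A a) ->
  finite_set F ->
  (forall r, mod_set n F r -> mod_set n A r) ->
  (forall r, mod_set n G r -> ~ mod_set n A r) ->
  (forall g1 g2, G g1 -> G g2 -> g1 mod n = g2 mod n) ->
  (exists S : Z -> Prop,
     (forall s, S s -> 0 <= s < n) /\
     (* (i) S + (W mod n) = Z/nZ *)
     (forall r, 0 <= r < n ->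
        exists s w, S s /\ mod_set n (union3 (dil_plus n A) F G) w /\
                    r = (s + w) mod n) /\
     (* (ii) *)
     (forall s, S s -> exists g, G g /\
        ~ (exists s' w, S s' /\ s' <> s /\
             mod_set n (union3 (dil_plus n A) F G) w /\
             (s + g mod n) mod n = (s' + w) mod n))) ->
  has_minimal_complement G ->
  has_minimal_complement (union3 (dil_plus n A) F G).
Proof.
  intros Hn _ [a0 Ha0] _ HFA HGA HGG (S & HS & Hcov & Hsep) [D [HD Dmin]].
  set (W := union3 (dil_plus n A) F G) in *.
  assert (HWA : forall w, W w -> ~ G w -> exists a, A a /\ w mod n = a mod n).
  { intros w [(k & a & _ & Ha & ->)|[Hw|Hw]] HnG; [| |contradiction].
    - exists a. split; [assumption|]. apply mod_eq_iff; [assumption|].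
      exists k. lia.
    - destruct (HFA (w mod n)) as (a & Ha & E).
      + exists w. auto.
      + exists a. auto. }
  assert (HWG : forall w g, W w -> G g -> w mod n = g mod n -> G w).
  { intros w g Hw Hg E. apply NNPP. intros HnG.
    destruct (HWA w Hw HnG) as (a & Ha & E').
    apply (HGA (g mod n)).
    - exists g. auto.
    - exists a. split; [assumption|congruence]. }
  destruct (classic (exists m, forall g, G g -> m <= g)) as [[m Hm]|Hunb].
  2: { apply unbounded_has_minimal_complement.
    - intros x. exists (n * Z.abs x + (a0 + n * Z.abs a0)). split; [|nia].
      left. exists (Z.abs x + Z.abs a0), a0. repeat split; [lia|assumption|lia].
    - intros x. apply NNPP. intros H. apply Hunb. exists x. intros g Hg.
      apply Z.nlt_ge. intros Hlt. apply H. exists g.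
      split; [right; right; assumption|lia]. }
  destruct (HD 0) as (_ & g0 & _ & Hg0 & _).
  assert (Hres : forall g, G g -> exists k, g = g0 + n * k).
  { intros g Hg. apply mod_eq_iff; auto. }
  (* The target represented below is at most [x + m], while [g >= m]; hence [d <= x]. Its class is
     that of [s + g0], which forces [d] into the class of [s]. *)
  assert (Dlow : forall s x, exists d, D d /\ d <= x /\ exists k, d = s + n * k).
  { intros s x.
    destruct (HD (s + g0 + n * (- Z.abs (s + g0) - Z.abs (x + m))))
      as (d & g & Hd & Hg & E).
    destruct (Hres g Hg) as [k Hk]. specialize (Hm g Hg).
    exists d. split; [assumption|]. split; [nia|].
    exists (- Z.abs (s + g0) - Z.abs (x + m) - k). lia. }
  exists (fun c => D c /\ S (c mod n)). split.
  - intros z.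
    destruct (Hcov (z mod n)) as (s & w' & Hs & (w & Hw & ->) & E).
    { apply Z.mod_pos_bound; assumption. }
    rewrite Z.add_mod_idemp_r in E by lia.
    apply mod_eq_iff in E; [|assumption]. destruct E as [k Hk].
    assert (Hsn : forall d, (exists j, d = s + n * j) -> S (d mod n)).
    { intros d Hd. apply mod_eq_iff in Hd; [|assumption].
      rewrite Hd, Z.mod_small; auto. }
    (* If [w] is in [G], any representation of [z] by [D] and [G] has its [D]-term in the class of
       [s]. Otherwise [w] is congruent to some [a], and a [d <= z - a] in the class of [s] leaves
       [z - d] in [n N + a]. *)
    destruct (classic (G w)) as [HGw|HGw].
    + destruct (HD z) as (d & g & Hd & Hg & Ez). exists d, g.
      split; [|split; [right; right; assumption|assumption]].
      split; [assumption|]. apply Hsn.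
      destruct (Hres g Hg) as [k1 H1]. destruct (Hres w HGw) as [k2 H2].
      exists (k + k2 - k1). lia.
    + destruct (HWA w Hw HGw) as (a & Ha & E).
      apply mod_eq_iff in E; [|assumption]. destruct E as [k1 H1].
      destruct (Dlow s (z - a)) as (d & Hd & Hle & k2 & H2).
      exists d, (z - d). split; [split; [assumption|apply Hsn; eauto]|].
      split; [|lia]. left. exists (k + k1 - k2), a.
      repeat split; [nia|assumption|lia].
  - intros C' Hsub HC' c [HDc HSc]. apply NNPP. intros Hc.
    (* If [C'] omits [c], it repairs every representation [z = c + g], contradicting the minimality
       of [D]. *)
    assert (H : additive_complement (remove_point D c) G).
    2: { destruct (Dmin _ (fun x H' => proj1 H') H c HDc) as [_ H']. auto. }
    intros z. destruct (HD z) as (d & g & Hd & Hg & Ez).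
    destruct (Z.eq_dec d c) as [->|Hne].
    2: { exists d, g. repeat split; assumption. }
    destruct (HC' z) as (c' & w & Hc' & Hw & Ez').
    destruct (Hsub c' Hc') as [HDc' HSc'].
    (* By (ii), applied to [g1] in the class of [g], the residue of [c + g] is reached only from
       that of [c]. Then [w] is congruent to [g], so it lies in [G]. *)
    assert (Hmod : c' mod n = c mod n).
    { apply NNPP. intros Hne.
      destruct (Hsep _ HSc) as (g1 & Hg1 & Hno). apply Hno.
      exists (c' mod n), (w mod n).
      repeat split; [assumption|assumption|exists w; auto|].
      rewrite (HGG g1 g Hg1 Hg), <- !Z.add_mod by lia. congruence. }
    exists c', w. split; [|split; [|assumption]].
    + split; [assumption|]. intros ->. contradiction.
    + apply (HWG w g Hw Hg). apply mod_eq_iff; [assumption|].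
      apply mod_eq_iff in Hmod; [|assumption]. destruct Hmod as [k Hk].
      exists (- k). lia.
Qed.
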